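(* Let $A,B$ be $n\times n$ complex matrices that are strict contractions, and let $\mathcal{C}(A)$ and $\mathcal{C}(B)$ be the Cayley transforms of $A$ and $B$, respectively. Then for every $k=1,\dots,n$ and all integers $1\le i_1<\cdots<i_k\le n$, $$\prod_{j=1}^k\frac{1-\sigma_{n-i_j+1}(A)}{1+\sigma_j(A)}\le\prod_{j=1}^k\sigma_{i_j}\big(\mathcal{C}(A)\big)\le\prod_{j=1}^k\frac{1+\sigma_{i_j}(A)}{1-\sigma_j(A)}$$ and $$\prod_{j=1}^k\frac{2\,\sigma_{i_j}(A-B)}{(1+\sigma_j(A))(1+\sigma_j(B))}\le\prod_{j=1}^k\sigma_{i_j}\big(\mathcal{C}(A)-\mathcal{C}(B)\big)\le\prod_{j=1}^k\frac{2\,\sigma_{i_j}(A-B)}{(1-\sigma_j(A))(1-\sigma_j(B))}.$$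
   Context: $I$ is the $n\times n$ identity matrix. For an $n\times n$ complex matrix $X$, $\sigma_1(X)\ge\sigma_2(X)\ge\cdots\ge\sigma_n(X)$ denote its singular values in non-increasing order. A strict contraction is a matrix all of whose singular values are less than $1$. If $X+iI$ is invertible (with $i$ the imaginary unit), the Cayley transform of $X$ is $\mathcal{C}(X)=(X-iI)(X+iI)^{-1}$; it is well defined for every strict contraction. The indices $i_1,\dots,i_k$ are integers, unrelated to the imaginary unit. *)

(* Defs.v *)
From HB Require Import structures.
From mathcomp Require Import all_boot all_order all_algebra.
From mathcomp Require Import spectral sesquilinear reals complex.
Set Implicit Arguments.
Unset Strict Implicit.
Unset Printing Implicit Defensive.
Import Order.TTheory GRing.Theory Num.Theory.
Local Open Scope ring_scope.
Local Open Scope sesquilinear_scope.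

(* The square roots of the eigenvalues of X^* X, counted with multiplicity:
   X^* X is Hermitian, so its spectral_diag is the diagonal of a unitary
   diagonalization, and its entries are real and nonnegative. *)
Definition singular_values (R : realType) (n : nat) (X : 'M[R[i]]_n) : seq R :=
  sort >=%R [seq Num.sqrt (complex.Re (spectral_diag (X ^t* *m X) 0 j))
            | j <- enum 'I_n].

(* Numbered from 1: only the indices 1 <= j <= n are meaningful. *)
Definition sigma (R : realType) (n : nat) (j : nat) (X : 'M[R[i]]_n) : R :=
  nth 0 (singular_values X) j.-1.

Definition strict_contraction (R : realType) (n : nat) (X : 'M[R[i]]_n) : Prop :=
  forall j : nat, (1 <= j <= n)%N -> sigma j X < 1.

(* Meaningful when X + iI is invertible, in particular when X is a strict
   contraction; invmx is the identity on singular matrices. *)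
Definition cayley (R : realType) (n : nat) (X : 'M[R[i]]_n) : 'M[R[i]]_n :=
  (X - ('i%C)%:M) *m invmx (X + ('i%C)%:M).

(* Main.v *)
Require Import Defs.
From HB Require Import structures.
From mathcomp Require Import all_boot all_order all_algebra.
From mathcomp Require Import reals complex.
From mathcomp Require Import zify.
From mathcomp Require Import perm spectral sesquilinear.
Import Order.TTheory GRing.Theory Num.Theory.
Local Open Scope ring_scope.
Local Open Scope sesquilinear_scope.
Local Open Scope complex_scope.

Set Implicit Arguments.
Unset Strict Implicit.
Unset Printing Implicit Defensive.

(** Everything rests on a multiplicative inequality of Gelfand-Naimark type:
    prod_j sigma_(i_j) (Y X) <= prod_j sigma_(i_j) (Y) sigma_j (X).

    Its proof is the multiplicative analogue of the argument of Li and Mathias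
    for the Lidskii-Mirsky-Wielandt theorem. Put c := sigma_k (X) and replace X
    by a matrix Z in which every singular value below c has been raised to c
    ([clip]). Nothing decreases on the left, and sigma_1, ..., sigma_k keep
    their values. Moreover |v Z| >= c |v| for every row v, so each of the n
    ratios sigma_j (Y Z) / (c sigma_j (Y)) is at least 1. Hence the product of
    the k ratios selected by the indices i_j is at most the product of all n of
    them, which multiplicativity of the determinant evaluates to
    prod_(j <= n) (sigma_j (Z) / c) = prod_(j <= k) (sigma_j (X) / c). This
    needs Y invertible ([gelfand_naimark_nonsingular]); in general Y is clipped
    too, at level sigma_(i_k) (Y), and if that level or c vanishes then so does
    sigma_(i_k) (Y X) ([gelfand_naimark]). Taking adjoints exchanges the two
    sides, and combining both forms gives a bound for products of three
    matrices ([gelfand_naimark_both]).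

    Singular values are handled through the norms |v X| of row vectors: the
    Courant-Fischer principle, in the form of [sigma_ge] and [sigma_le], bounds
    sigma_j (X) as soon as |v X| is compared with |v| on a subspace of suitable
    dimension. It gives monotonicity, the bounds
    1 - sigma_(n-j+1) (A) <= sigma_j (A -+ iI) <= 1 + sigma_j (A), and
    sigma_j ((A + iI)^-1) <= 1 / (1 - sigma_j (A)).

    With S_A := A + iI, the four estimates follow by applying the product
    inequality to
      C(A) S_A = A - iI,
      C(A) = (A - iI) S_A^-1,
      S_B (C(A) - C(B)) S_A = 2i (A - B),
      C(A) - C(B) = 2i S_B^-1 (A - B) S_A^-1:
    the lower bounds come from reading the first and third identities as
    factorizations of the known matrix. *)

(** * Characteristic polynomials of products *)

(** For a square matrix, det (X - AB) = det (X - BA): the two block products in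
    the proof express det [[X, A], [B, 1]] through either side, up to a factor
    X^n that can be cancelled. This makes X^* X and X X^* isospectral. *)
Lemma char_poly_mulC (F : idomainType) (n : nat) (A B : 'M[F]_n) :
  char_poly (A *m B) = char_poly (B *m A).
Proof.
pose a := map_mx polyC A; pose b := map_mx polyC B.
have E : block_mx ('X%:M) a b 1%:M *m block_mx 1%:M (- a) 0 ('X%:M)
   = block_mx ('X%:M) 0 b (char_poly_mx (B *m A)).
  rewrite mulmx_block !(mulmx1, mul1mx, mulmx0, mul0mx, addr0, mulmxN).
  rewrite mul_scalar_mx mul_mx_scalar addNr addrC; congr block_mx.
  by rewrite /char_poly_mx map_mxM.
have F1 : block_mx ('X%:M) a b 1%:M *m block_mx 1%:M 0 (- b) 1%:M
   = block_mx (char_poly_mx (A *m B)) a 0 1%:M.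
  rewrite mulmx_block !(mulmx1, mul1mx, mulmx0, mul0mx, addr0, add0r, mulmxN).
  by rewrite subrr /char_poly_mx map_mxM.
move/(congr1 determinant): E; move/(congr1 determinant): F1.
rewrite !det_mulmx !det_ublock !det_lblock !det1 !mulr1 !mul1r => -> E.
apply/(mulIf _ (etrans E (mulrC _ _))).
by rewrite det_scalar expf_neq0 ?polyX_eq0.
Qed.

(** * The embedding of the reals in the complex numbers *)

Section RealEmbedding.
Variable R : realType.
Implicit Types a b : R.

Lemma realcD a b : (a + b)%:C = a%:C + b%:C.
Proof. exact: rmorphD. Qed.

Lemma realcM a b : (a * b)%:C = a%:C * b%:C.
Proof. exact: rmorphM. Qed.

Lemma realcX a m : (a ^+ m)%:C = a%:C ^+ m.
Proof. exact: rmorphXn. Qed.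

Lemma realc_sum (I : Type) (r : seq I) (F : I -> R) :
  (\sum_(j <- r) F j)%:C = \sum_(j <- r) (F j)%:C.
Proof. exact: rmorph_sum. Qed.

End RealEmbedding.

(** * Euclidean norm of row vectors *)

(** The real-valued norm attached to [dotmx]; it is locked because unification
    would otherwise unfold the complex square root. *)
HB.lock Definition vnorm (R : realType) (n : nat) (v : 'rV[R[i]]_n) : R :=
  complex.Re (sqrtC (dotmx v v)).

Section VectorNorm.
Variables (R : realType) (n : nat).
Implicit Types (u v : 'rV[R[i]]_n) (X Y : 'M[R[i]]_n).

Lemma dotmx_ge0 v : 0 <= dotmx v v.
Proof. exact: dnorm_ge0. Qed.

Lemma vnormE v : (vnorm v)%:C = sqrtC (dotmx v v).
Proof.
by rewrite vnorm.unlock RRe_real // ger0_real // sqrtC_ge0 dotmx_ge0.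
Qed.

Lemma vnorm_sqr v : ((vnorm v) ^+ 2)%:C = dotmx v v.
Proof. by rewrite realcX vnormE sqrtCK. Qed.

Lemma vnorm_ge0 v : 0 <= vnorm v.
Proof. by rewrite -lecR vnormE sqrtC_ge0 dotmx_ge0. Qed.

Lemma vnorm_gt0 v : v != 0 -> 0 < vnorm v.
Proof. by move=> v0; rewrite -ltcR vnormE sqrtC_gt0 dotmx_is_dotmx. Qed.

Lemma ler_vnormD u v : vnorm (u + v) <= vnorm u + vnorm v.
Proof.
rewrite -lecR realcD.
rewrite (vnormE (u + v)) (vnormE u) (vnormE v).
exact: (triangle_lerif (@dotmx R[i] n) u v).
Qed.

Lemma vnormZ (a : R[i]) v : vnorm (a *: v) = Normc.normc a * vnorm v.
Proof.
apply: complexI; rewrite realcM (vnormE (a *: v)) (vnormE v).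
rewrite (dnormZ (@dotmx R[i] n)).
rewrite sqrtCM ?nnegrE ?exprn_ge0 ?dotmx_ge0 ?normr_ge0 //.
rewrite sqrCK ?normr_ge0 // normc_def.
Qed.

(** In the coordinates u of a vector in an eigenbasis P of X X^*, the map
    v |-> |v X|^2 is diagonal. *)
Lemma vnorm_diag (P X : 'M[R[i]]_n) (s : 'I_n -> R) u :
  P \is unitarymx ->
  X *m X ^t* = P ^t* *m diag_mx (\row_j ((s j) ^+ 2)%:C) *m P ->
  vnorm (u *m P *m X) ^+ 2 = \sum_j s j ^+ 2 * Normc.normc (u 0 j) ^+ 2.
Proof.
move=> Pu XE; apply: complexI; rewrite vnorm_sqr dotmxE.
rewrite !trmx_mul !map_mxM !mulmxA -(mulmxA _ X) XE !mulmxA mulmxtVK //.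
rewrite mulmxtVK // mul_mx_diag mxE realc_sum; apply: eq_bigr => j _.
rewrite !mxE realcM mulrAC -normCK mulrC !realcX normc_def.
by case: (u 0 j).
Qed.

Lemma vnorm_unitary (P : 'M[R[i]]_n) u :
  P \is unitarymx -> vnorm (u *m P) ^+ 2 = \sum_j Normc.normc (u 0 j) ^+ 2.
Proof.
move=> Pu; rewrite -[u *m P]mulmx1 (@vnorm_diag P 1%:M (fun=> 1)) //.
  by apply: eq_bigr => j _; rewrite expr1n mul1r.
have /mulmx1C PP := unitarymxP Pu.
rewrite trmx1 map_mx1 mulmx1 -[LHS]PP; congr (_ *m _).
rewrite -[LHS]mulmx1; congr (_ *m _).
by apply/matrixP=> i j; rewrite !mxE expr1n.
Qed.

End VectorNorm.

(** * Diagonalization and basic properties of singular values *)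

Section SingularBasis.
Variables (R : realType) (n : nat).
Implicit Types (X Y P : 'M[R[i]]_n) (s : 'I_n -> R).

(** The eigenvalues of X X^* are squared norms of the rows of P X, hence squares
    of nonnegative reals. *)
Lemma psd_diagonalization X : exists P s,
  [/\ P \is unitarymx, forall j, 0 <= s j &
      X *m X ^t* = P ^t* *m diag_mx (\row_j ((s j) ^+ 2)%:C) *m P].
Proof.
set M := X *m X ^t*.
have Mn : M \is normalmx.
  apply/normalmxP.
  by rewrite /M !trmx_mul !map_mxM trmxCK.
set P := spectralmx M; set d := spectral_diag M.
have Pu : P \is unitarymx := spectral_unitarymx M.
have ME : M = P ^t* *m diag_mx d *m P.
  by rewrite -(invmx_unitary Pu); have /orthomx_spectralP := Mn.
have d_ge0 j : 0 <= d 0 j.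
  have -> : d 0 j = dotmx (row j (P *m X)) (row j (P *m X)).
    have : (P *m M *m P ^t*) j j = d 0 j.
      rewrite ME !mulmxA (unitarymxP Pu) mul1mx mulmxtVK //.
      by rewrite mxE eqxx mulr1n.
    move=> <-; have -> : P *m M *m P ^t* = P *m X *m (P *m X) ^t*.
      by rewrite trmx_mul map_mxM !mulmxA.
    by rewrite dotmxE !mxE; apply: eq_bigr => l _; rewrite !mxE.
  exact: dotmx_ge0.
exists P, (fun j => Num.sqrt (complex.Re (d 0 j))).
split; [exact: Pu | by move=> j; exact: sqrtr_ge0 |].
suff <- : d = \row_j ((Num.sqrt (complex.Re (d 0 j))) ^+ 2)%:C by [].
apply/rowP=> j; rewrite [RHS]mxE sqr_sqrtr.
  by rewrite RRe_real // ger0_real.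
by have := d_ge0 j; rewrite lecE => /andP[].
Qed.

Lemma char_poly_unitary_diag P (d : 'rV[R[i]]_n) : P \is unitarymx ->
  char_poly (P ^t* *m diag_mx d *m P) = \prod_j ('X - (d 0 j)%:P).
Proof.
move=> Pu; rewrite char_poly_mulC mulmxA (unitarymxP Pu) mul1mx.
rewrite char_poly_trig ?diag_mx_is_trig //.
by apply: eq_bigr => j _; rewrite mxE eqxx mulr1n.
Qed.

(** The characteristic polynomial determines the multiset of eigenvalues, so any
    diagonalization computes the singular values, not only [spectral_diag]. *)
Lemma singular_values_char_poly X s : (forall j, 0 <= s j) ->
  char_poly (X ^t* *m X) = \prod_j ('X - (((s j) ^+ 2)%:C)%:P) ->
  singular_values X = sort >=%R [seq s j | j <- enum 'I_n].
Proof.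
move=> s_ge0 cE; rewrite /singular_values; set M := X ^t* *m X in cE *.
have Mn : M \is normalmx.
  apply/normalmxP.
  by rewrite /M !trmx_mul !map_mxM trmxCK.
have /orthomx_spectralP ME := Mn.
move: cE; rewrite {1}ME invmx_unitary ?spectral_unitarymx //.
rewrite char_poly_unitary_diag ?spectral_unitarymx // => cE.
have : perm_eq [seq spectral_diag M 0 j | j <- enum 'I_n]
               [seq ((s j) ^+ 2)%:C | j <- enum 'I_n].
  by apply: prod_XsubC_eq; rewrite !big_map -!enumT !big_enum; exact: cE.
move=> /(perm_map (Num.sqrt \o @complex.Re R)); rewrite -!map_comp => pE.
apply/perm_sortP => //.
- by move=> a b; apply: le_total.
- by move=> a b c; rewrite /= => ab ca; apply: le_trans ca ab.
- by move=> a b; rewrite /= andbC => /le_anti.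
apply: (perm_trans pE); rewrite (eq_map (_ : _ =1 s)) // => j /=.
by rewrite sqrtr_sqr ger0_norm.
Qed.

Lemma singular_values_diag P X s : P \is unitarymx -> (forall j, 0 <= s j) ->
  X *m X ^t* = P ^t* *m diag_mx (\row_j ((s j) ^+ 2)%:C) *m P ->
  singular_values X = sort >=%R [seq s j | j <- enum 'I_n].
Proof.
move=> Pu s0 XE; apply: singular_values_char_poly => //.
rewrite char_poly_mulC XE char_poly_unitary_diag //.
by apply: eq_bigr => j _; rewrite mxE.
Qed.

(** The row norms |v X| are governed by X X^*, whereas [sigma] is defined from
    X^* X; isospectrality reconciles the two and lets adjoints exchange the
    factors of a product. *)
Lemma sigma_adj j X : sigma j (X ^t*) = sigma j X.
Proof.
have [P [s [Pu s0 XE]]] := psd_diagonalization X.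
rewrite /sigma (singular_values_diag Pu s0 XE).
rewrite (@singular_values_char_poly (X ^t*) s) // trmxCK XE.
rewrite char_poly_unitary_diag //.
by apply: eq_bigr => l _; rewrite mxE.
Qed.

Lemma size_singular_values X : size (singular_values X) = n.
Proof. by rewrite size_sort size_map size_enum_ord. Qed.

Lemma sigma_ge0 j X : 0 <= sigma j X.
Proof.
rewrite /sigma; have [jn|jn] := ltnP j.-1 (size (singular_values X)).
  have := mem_nth 0 jn; rewrite mem_sort => /mapP[l _ ->].
  exact: sqrtr_ge0.
by rewrite nth_default.
Qed.

Lemma sigma_antitone j l X : (j <= l)%N -> sigma l X <= sigma j X.
Proof.
move=> jl; rewrite {1}/sigma.
have [ln|ln] := ltnP l.-1 (size (singular_values X)); last first.
  by rewrite nth_default // sigma_ge0.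
have jl' : (j.-1 <= l.-1)%N by rewrite -!subn1 leq_sub2r.
apply: (@sorted_leq_nth _ >=%R) => //.
- by move=> a b c; rewrite /= => ab ca; apply: le_trans ca ab.
- by move=> a; apply: lexx.
- by rewrite /singular_values sort_sorted // => a b; apply: le_total.
- exact: leq_ltn_trans ln.
Qed.

(** An orthonormal eigenbasis of X X^* enumerated in the order of [sigma]; rows
    of P are numbered from 0, singular values from 1. *)
Lemma singular_basis X : exists2 P : 'M[R[i]]_n, P \is unitarymx &
  X *m X ^t* = P ^t* *m diag_mx (\row_j ((sigma j.+1 X) ^+ 2)%:C) *m P.
Proof.
have [Q [s [Qu s0 XE]]] := psd_diagonalization X.
have : perm_eq (singular_values X) (mktuple s).
  by rewrite (singular_values_diag Qu s0 XE) perm_sort.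
move=> /tuple_permP[p pE].
have sigE (j : 'I_n) : sigma j.+1 X = s (p j).
  by rewrite /sigma pE -tnth_nth !tnth_mktuple.
exists (row_perm p Q).
  apply/row_unitarymxP => a b.
  have rowE c : row c (row_perm p Q) = row (p c) Q.
    by apply/rowP=> l; rewrite !mxE.
  by rewrite !rowE (row_unitarymxP Qu) (inj_eq perm_inj).
rewrite XE; apply/matrixP=> a b; rewrite !mul_mx_diag !mxE.
rewrite [LHS](reindex_perm p); apply: eq_bigr => j _.
by rewrite !mxE sigE.
Qed.

End SingularBasis.

(** * The Courant-Fischer principle and its consequences *)

Section CourantFischer.
Variables (R : realType) (n : nat).
Implicit Types (X Y P : 'M[R[i]]_n) (u v : 'rV[R[i]]_n).

(** The first j rows of a singular basis span this subspace. *)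
Lemma top_subspace j X : (1 <= j <= n)%N -> exists2 W : 'M[R[i]]_n,
  \rank W = j & forall v, (v <= W)%MS -> sigma j X * vnorm v <= vnorm (v *m X).
Proof.
case/andP=> j1 jn; have [P Pu XE] := singular_basis X.
exists (pid_mx j *m P).
  by rewrite mxrankMfree ?row_free_unit ?unitarymx_unit // rank_pid_mx.
move=> v /submxP[w ->]; rewrite mulmxA; set u := w *m _.
have u0 (l : 'I_n) : (j <= l)%N -> u 0 l = 0.
  move=> jl; rewrite mxE big1 // => k _; rewrite mxE; case: eqP => [->|_].
    by rewrite ltnNge jl mulr0.
  by rewrite mulr0.
rewrite -ler_sqr ?nnegrE ?mulr_ge0 ?vnorm_ge0 ?sigma_ge0 // exprMn.
rewrite (vnorm_diag _ Pu XE) vnorm_unitary //.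
rewrite mulr_sumr; apply: ler_sum => l _.
have [lj|jl] := ltnP l j; last by rewrite u0 // Normc.normc0 expr0n !mulr0.
by rewrite ler_wpM2r ?sqr_ge0 // ler_sqr ?nnegrE ?sigma_ge0 // sigma_antitone.
Qed.

(** The complementary extremal subspace is spanned by the rows of a singular
    basis from the j-th one on, so its dimension is n - j + 1. *)
Lemma bottom_subspace j X : (1 <= j <= n)%N -> exists2 W : 'M[R[i]]_n,
  (\rank W + j = n.+1)%N &
  forall v, (v <= W)%MS -> vnorm (v *m X) <= sigma j X * vnorm v.
Proof.
case/andP=> j1 jn; have [P Pu XE] := singular_basis X.
exists (copid_mx j.-1 *m P).
  rewrite mxrankMfree ?row_free_unit ?unitarymx_unit // rank_copid_mx.
    by rewrite -{2}(prednK j1) addnS subnK // (leq_trans (leq_pred j)).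
  exact: leq_trans (leq_pred j) jn.
move=> v /submxP[w ->]; rewrite mulmxA; set u := w *m _.
have u0 (l : 'I_n) : (l < j.-1)%N -> u 0 l = 0.
  move=> lj; rewrite mxE big1 // => k _; rewrite !mxE.
  case: (eqVneq k l) => [->|kl]; first by rewrite eqxx lj subrr mulr0.
  by move: kl; rewrite -val_eqE => /negbTE ->; rewrite subrr mulr0.
rewrite -ler_sqr ?nnegrE ?mulr_ge0 ?vnorm_ge0 ?sigma_ge0 // exprMn.
rewrite (vnorm_diag _ Pu XE) vnorm_unitary //.
rewrite mulr_sumr; apply: ler_sum => l _.
have [lj|jl] := ltnP l j.-1; first by rewrite u0 // Normc.normc0 expr0n !mulr0.
rewrite ler_wpM2r ?sqr_ge0 // ler_sqr ?nnegrE ?sigma_ge0 // sigma_antitone //.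
by rewrite -(prednK j1).
Qed.

Lemma subspaces_meet m p (U : 'M[R[i]]_(m, n)) (V : 'M[R[i]]_(p, n)) :
  (n < \rank U + \rank V)%N ->
  exists v, [/\ (v <= U)%MS, (v <= V)%MS & 0 < vnorm v].
Proof.
move=> UV; exists (nz_row (U :&: V)%MS).
have := nz_row_sub (U :&: V)%MS; rewrite sub_capmx => /andP[-> ->]; split=> //.
apply: vnorm_gt0; rewrite nz_row_eq0 -mxrank_eq0 -lt0n.
rewrite -(ltn_add2l (\rank (U + V)%MS)) addn0 mxrank_sum_cap.
exact: leq_ltn_trans (rank_leq_col _) UV.
Qed.

(** Max-min half of Courant-Fischer: a subspace of dimension at least j meets
    the bottom subspace, of dimension n - j + 1, in a nonzero vector. *)
Lemma sigma_ge m j X (W : 'M[R[i]]_(m, n)) c : (1 <= j <= n)%N ->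
  (j <= \rank W)%N ->
  (forall v, (v <= W)%MS -> c * vnorm v <= vnorm (v *m X)) ->
  c <= sigma j X.
Proof.
move=> jn jW Wc; have [V rV Vle] := bottom_subspace X jn.
have [|v [vW vV v0]] := @subspaces_meet _ _ W V.
  by rewrite -rV addnC leq_add2r.
by rewrite -(ler_pM2r v0) (le_trans (Wc _ vW)) ?Vle.
Qed.

(** Min-max half: here the subspace meets the top subspace of dimension j. *)
Lemma sigma_le m j X (W : 'M[R[i]]_(m, n)) c : (1 <= j <= n)%N ->
  (n < \rank W + j)%N ->
  (forall v, (v <= W)%MS -> vnorm (v *m X) <= c * vnorm v) ->
  sigma j X <= c.
Proof.
move=> jn jW Wc; have [V rV Vge] := top_subspace X jn.
have [|v [vW vV v0]] := @subspaces_meet _ _ W V; first by rewrite rV.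
by rewrite -(ler_pM2r v0) (le_trans (Vge _ vV)) ?Wc.
Qed.

Lemma sigma_mono j X Y : (1 <= j <= n)%N ->
  (forall v, vnorm (v *m X) <= vnorm (v *m Y)) -> sigma j X <= sigma j Y.
Proof.
move=> jn XY; have [W rW Wge] := top_subspace X jn.
apply: (sigma_ge (W := W)); rewrite ?rW // => v vW.
exact: le_trans (Wge v vW) (XY v).
Qed.

Lemma sigma_scale j (a : R[i]) X : (1 <= j <= n)%N ->
  sigma j (a *: X) = Normc.normc a * sigma j X.
Proof.
have a0 : 0 <= Normc.normc a by case: a => x y; exact: sqrtr_ge0.
move=> jn; apply/eqP; rewrite eq_le; apply/andP; split.
  have [W rW Wle] := bottom_subspace X jn.
  apply: (sigma_le (W := W)); rewrite ?rW // => v vW.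
  by rewrite -scalemxAr vnormZ -mulrA ler_wpM2l // Wle.
have [W rW Wge] := top_subspace X jn.
apply: (sigma_ge (W := W)); rewrite ?rW // => v vW.
by rewrite -scalemxAr vnormZ -mulrA ler_wpM2l // Wge.
Qed.

Lemma det_sigma X :
  (\prod_(1 <= j < n.+1) sigma j X ^+ 2)%:C = `|\det X| ^+ 2.
Proof.
have [P Pu XE] := singular_basis X.
have := congr1 determinant XE.
rewrite !det_mulmx mulrAC -[X in _ = X * _]det_mulmx.
have /mulmx1C -> := unitarymxP Pu.
rewrite det1 mul1r det_diag det_map_mx det_tr -normCK => ->.
rewrite rmorph_prod big_add1 big_mkord /=.
by apply: eq_bigr => j _; rewrite mxE.
Qed.

(** Both sides are the absolute value of a determinant, by [det_sigma]. *)
Lemma prod_sigma_mul X Y : \prod_(1 <= j < n.+1) sigma j (X *m Y) =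
  (\prod_(1 <= j < n.+1) sigma j X) * \prod_(1 <= j < n.+1) sigma j Y.
Proof.
have p0 Z : 0 <= \prod_(1 <= j < n.+1) sigma j Z.
  by apply: prodr_ge0 => j _; exact: sigma_ge0.
apply/eqP; rewrite -(@eqrXn2 _ 2) ?mulr_ge0 ?p0 // exprMn -!prodrXl; apply/eqP.
apply: complexI; rewrite rmorphM /= !det_sigma.
by rewrite det_mulmx normrM exprMn.
Qed.

Lemma unitmx_sigma X : (1 <= n)%N -> 0 < sigma n X -> X \in unitmx.
Proof.
move=> n1 s0; rewrite unitmxE unitfE -normr_eq0 -sqrf_eq0 -det_sigma.
rewrite (inj_eq (@complexI R) _ 0) gt_eqF //.
rewrite big_nat; apply: prodr_gt0 => j /andP[_ jn].
by rewrite exprn_gt0 // (lt_le_trans s0) // sigma_antitone.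
Qed.

(** Z Z^* is diagonal in an orthonormal eigenbasis of X X^*, with the entries
    max (sigma_j (X), c)^2, so the norms can be compared coordinatewise. *)
Lemma clip X (c : R) : 0 < c -> exists Z : 'M[R[i]]_n,
  [/\ forall v, vnorm (v *m X) <= vnorm (v *m Z),
      forall v, c * vnorm v <= vnorm (v *m Z) &
      forall j, (1 <= j <= n)%N -> sigma j Z = Num.max (sigma j X) c].
Proof.
move=> c0; have [P Pu XE] := singular_basis X.
pose s (j : 'I_n) := Num.max (sigma j.+1 X) c.
have s0 j : 0 <= s j by rewrite le_max sigma_ge0.
exists (P ^t* *m diag_mx (\row_j (s j)%:C)).
set Z := _ *m _.
have ZE : Z *m Z ^t* = P ^t* *m diag_mx (\row_j ((s j) ^+ 2)%:C) *m P.
  rewrite trmx_mul map_mxM trmxCK !mulmxA; congr (_ *m _).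
  rewrite -mulmxA; congr (_ *m _); rewrite tr_diag_mx map_diag_mx mulmx_diag.
  congr diag_mx; apply/rowP=> j; rewrite !mxE rmorphXn /= expr2; congr (_ * _).
  by apply/CrealP; rewrite ger0_real // ler0c.
split=> [v|v|j /andP[j1 jn]].
- have -> : v = v *m P ^t* *m P by rewrite mulmxKtV.
  rewrite -ler_sqr ?nnegrE ?vnorm_ge0 //.
  rewrite (vnorm_diag _ Pu XE) (vnorm_diag _ Pu ZE).
  apply: ler_sum => l _; rewrite ler_wpM2r ?sqr_ge0 //.
  by rewrite ler_sqr ?nnegrE ?sigma_ge0 // le_max lexx.
- have -> : v = v *m P ^t* *m P by rewrite mulmxKtV.
  rewrite -ler_sqr ?nnegrE ?mulr_ge0 ?vnorm_ge0 ?(ltW c0) // exprMn.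
  rewrite (vnorm_diag _ Pu ZE) vnorm_unitary // mulr_sumr.
  apply: ler_sum => l _; rewrite ler_wpM2r ?sqr_ge0 //.
  by rewrite ler_sqr ?nnegrE ?(ltW c0) // le_max lexx orbT.
have nthE l : (l < n)%N ->
    nth 0 [seq s j | j <- enum 'I_n] l = Num.max (sigma l.+1 X) c.
  move=> ln; rewrite (nth_map (Ordinal ln)) ?size_enum_ord //.
  by rewrite /s nth_enum_ord.
rewrite {1}/sigma (singular_values_diag Pu s0 ZE) sorted_sort.
- by rewrite nthE prednK.
- by move=> a b d; rewrite /= => ab ca; apply: le_trans ca ab.
apply/(sortedP 0) => l; rewrite size_map size_enum_ord => ln.
by rewrite /= !nthE ?(ltnW ln) // ge_max !le_max sigma_antitone // lexx orbT.
Qed.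

End CourantFischer.

(** * Singular values of products *)

Lemma ler_prod_nat (R : realType) (m n : nat) (F G : nat -> R) :
  (forall j, (m <= j < n)%N -> 0 <= F j <= G j) ->
  \prod_(m <= j < n) F j <= \prod_(m <= j < n) G j.
Proof. by move=> FG; rewrite big_nat [leRHS]big_nat; exact: ler_prod. Qed.

Section GelfandNaimark.
Variables (R : realType) (n k : nat) (i : nat -> nat).
Hypothesis hk : (1 <= k <= n)%N.
Hypothesis i_range : forall j : nat, (1 <= j <= k)%N -> (1 <= i j <= n)%N.
Hypothesis i_incr : forall j l : nat,
  (1 <= j)%N -> (j < l)%N -> (l <= k)%N -> (i j < i l)%N.
Implicit Types (X Y : 'M[R[i]]_n).

Lemma index_le_last j : (1 <= j <= k)%N -> (i j <= i k)%N.
Proof.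
case/andP=> j1; rewrite leq_eqVlt => /predU1P[-> //|jk].
exact/ltnW/i_incr.
Qed.

Lemma leq_index j : (1 <= j <= k)%N -> (j <= i j)%N.
Proof.
elim: j => // j IHj /andP[_ jk]; case: j => [|j] in IHj jk *.
  by have /andP[] := @i_range 1 jk.
by apply: leq_ltn_trans (IHj _) (i_incr _ _ _) => //; apply: ltnW.
Qed.

(** Strictly increasing indices select distinct factors, and the omitted factors
    are at least 1. *)
Lemma prod_subset_le (a : nat -> R) :
  (forall j, (1 <= j <= n)%N -> 1 <= a j) ->
  \prod_(1 <= j < k.+1) a (i j) <= \prod_(1 <= j < n.+1) a j.
Proof.
move=> a1; rewrite -(big_map i xpredT a); set r := map i _.
have r_uniq : uniq r.
  rewrite map_inj_in_uniq ?iota_uniq // => j l.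
  rewrite !mem_index_iota !ltnS => /andP[j1 jk] /andP[l1 lk] ijl.
  case: (ltngtP j l) => // [jl|lj].
    by have := i_incr j1 jl lk; rewrite ijl ltnn.
  by have := i_incr l1 lj jk; rewrite ijl ltnn.
have r_sub j : j \in r -> (1 <= j <= n)%N.
  by case/mapP=> l; rewrite mem_index_iota ltnS => lk ->; exact: i_range.
rewrite [leRHS](bigID (mem r)) /= -[X in _ <= X * _]big_filter.
rewrite [X in _ <= X * _](perm_big r) /=; last first.
  apply: uniq_perm; rewrite ?filter_uniq ?iota_uniq // => j.
  rewrite mem_filter mem_index_iota ltnS /=.
  by have [/r_sub ->|] := boolP (j \in r).
rewrite ler_peMr //.
  rewrite big_seq prodr_ge0 // => j /r_sub jn.
  exact: le_trans ler01 (a1 j jn).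
rewrite big_seq_cond.
apply: (big_ind (fun x => 1 <= x)) => [//|x y x1 y1|j].
  by rewrite -[1]mulr1 ler_pM.
by rewrite mem_index_iota ltnS => /andP[jn _]; exact: a1.
Qed.

(** The core of the argument: a j below are the ratios whose full product is a
    quotient of determinants. *)
Lemma gelfand_naimark_nonsingular X Y : 0 < sigma k X -> 0 < sigma n Y ->
  \prod_(1 <= j < k.+1) sigma (i j) (Y *m X)
    <= \prod_(1 <= j < k.+1) (sigma (i j) Y * sigma j X).
Proof.
set c := sigma k X => c0 Yn0.
have Y0 j : (1 <= j <= n)%N -> 0 < sigma j Y.
  by case/andP=> _ jn; apply: lt_le_trans Yn0 (sigma_antitone _ jn).
have [Z [XZ cZ sZ]] := clip X c0.
pose a j := sigma j (Y *m Z) / (c * sigma j Y).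
have a1 j : (1 <= j <= n)%N -> 1 <= a j.
  move=> jn; rewrite ler_pdivlMr ?mul1r ?mulr_gt0 ?Y0 //.
  have [W rW Wge] := top_subspace Y jn.
  apply: (sigma_ge (W := W)); rewrite ?rW // => v vW.
  by rewrite mulmxA (le_trans _ (cZ _)) // -mulrA ler_wpM2l ?Wge ?ltW.
have aE : \prod_(1 <= j < n.+1) a j = \prod_(1 <= j < k.+1) (sigma j X / c).
  rewrite prodf_div prod_sigma_mul big_split /=.
  have nz : \prod_(1 <= j < n.+1) sigma j Y != 0.
    rewrite gt_eqF // big_nat; apply: prodr_gt0 => j; exact: Y0.
  rewrite [_ * \prod_(_ <= _ < _) sigma _ Y]mulrC -mulf_div divff // mul1r.
  rewrite -prodf_div; case/andP: (hk) => k1 kn.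
  (* Beyond the index k the clipped singular values equal c. *)
  rewrite (big_cat_nat (n := k.+1)) //=.
  rewrite [X in _ * X]big_nat [X in _ * X]big1 ?mulr1; last first.
    move=> j /andP[kj jn]; rewrite sZ; last by rewrite (leq_trans _ kj).
    by rewrite max_r ?divff ?gt_eqF // sigma_antitone // ltnW.
  apply: eq_big_nat => j /andP[j1 jk].
  have jn : (1 <= j <= n)%N by rewrite j1 (leq_trans _ kn).
  by rewrite sZ // max_l // sigma_antitone.
apply: (@le_trans _ _ (\prod_(1 <= j < k.+1) (a (i j) * (c * sigma (i j) Y)))).
  apply: ler_prod_nat => j jk; rewrite sigma_ge0 /=.
  have ij := i_range jk.
  have cY : c * sigma (i j) Y != 0 by rewrite gt_eqF // mulr_gt0 // Y0.
  rewrite /a (divfK cY).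
  by apply: sigma_mono => // v; rewrite !mulmxA.
rewrite big_split /=.
have -> : \prod_(1 <= j < k.+1) (sigma (i j) Y * sigma j X) =
    \prod_(1 <= j < k.+1) (sigma j X / c)
    * \prod_(1 <= j < k.+1) (c * sigma (i j) Y).
  rewrite -big_split /=; apply: eq_bigr => j _.
  by rewrite mulrA divfK ?gt_eqF // mulrC.
rewrite -aE ler_wpM2r ?prod_subset_le //.
by apply: prodr_ge0 => j _; rewrite mulr_ge0 ?sigma_ge0 ?ltW.
Qed.

Lemma prod_sigma_eq0 X : sigma (i k) X = 0 ->
  \prod_(1 <= j < k.+1) sigma (i j) X = 0.
Proof.
by move=> X0; case/andP: hk => k1 kn; rewrite big_nat_recr //= X0 mulr0.
Qed.

(** Reduction to the nonsingular case. The last factor on the left vanishes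
    when sigma_k (X) = 0, because k <= i_k, or when sigma_(i_k) (Y) = 0.
    Otherwise Y may be clipped at sigma_(i_k) (Y), which leaves all the
    sigma_(i_j) (Y) unchanged; the clipping applies to Y^* since Y stands on
    the left of the product. *)
Theorem gelfand_naimark X Y :
  \prod_(1 <= j < k.+1) sigma (i j) (Y *m X)
    <= \prod_(1 <= j < k.+1) (sigma (i j) Y * sigma j X).
Proof.
have k1k : (1 <= k <= k)%N by case/andP: hk => ->/=.
have ikn := i_range k1k; have /andP[ik1 ikn'] := ikn.
have rhs0 : 0 <= \prod_(1 <= j < k.+1) (sigma (i j) Y * sigma j X).
  by apply: prodr_ge0 => j _; rewrite mulr_ge0 ?sigma_ge0.
have [X0|X0] := ltP 0 (sigma k X); last first.
  rewrite prod_sigma_eq0 //; apply/eqP; rewrite eq_le sigma_ge0 andbT.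
  apply: le_trans (sigma_antitone _ (leq_index k1k)) _.
  (* X^* kills its bottom subspace, hence so does X^* Y^*. *)
  rewrite -sigma_adj trmx_mul map_mxM.
  have [W rW Wle] := bottom_subspace (X ^t*) hk.
  apply: (sigma_le (W := W)); rewrite ?rW // => v /Wle.
  rewrite sigma_adj mul0r => vX; rewrite mulmxA.
  have -> : v *m X ^t* = 0.
    apply/eqP; apply: contraT => /vnorm_gt0; rewrite ltNge.
    by rewrite (le_trans vX) // mulr_le0_ge0 ?vnorm_ge0.
  by rewrite mul0mx -(scale0r 0) vnormZ Normc.normc0 mul0r.
have [Y0|Y0] := ltP 0 (sigma (i k) Y); last first.
  rewrite prod_sigma_eq0 //; apply/eqP; rewrite eq_le sigma_ge0 andbT.
  have [W rW Wle] := bottom_subspace Y ikn.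
  apply: (sigma_le (W := W)); rewrite ?rW // => v /Wle vY.
  rewrite mul0r mulmxA.
  have -> : v *m Y = 0.
    apply/eqP; apply: contraT => /vnorm_gt0; rewrite ltNge.
    by rewrite (le_trans vY) // mulr_le0_ge0 ?vnorm_ge0.
  by rewrite mul0mx -(scale0r 0) vnormZ Normc.normc0 mul0r.
have [Z [YZ cZ sZ]] := clip (Y ^t*) Y0.
have ZE j : (1 <= j <= n)%N ->
    sigma j (Z ^t*) = Num.max (sigma j Y) (sigma (i k) Y).
  by move=> jn; rewrite sigma_adj sZ // sigma_adj.
have Zn : 0 < sigma n (Z ^t*).
  rewrite ZE ?leqnn ?andbT; last by case/andP: hk => k1; apply: leq_trans.
  by rewrite lt_max Y0 orbT.
have -> : \prod_(1 <= j < k.+1) (sigma (i j) Y * sigma j X)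
        = \prod_(1 <= j < k.+1) (sigma (i j) (Z ^t*) * sigma j X).
  apply: eq_big_nat => j jk.
  by rewrite ZE ?i_range // max_l // sigma_antitone // index_le_last.
apply: le_trans (gelfand_naimark_nonsingular X0 Zn).
apply: ler_prod_nat => j jk; rewrite sigma_ge0 /=.
rewrite -sigma_adj -[leRHS]sigma_adj !trmx_mul !map_mxM trmxCK.
by apply: sigma_mono; rewrite ?i_range // => v; rewrite !mulmxA.
Qed.

Corollary gelfand_naimark_left X Y :
  \prod_(1 <= j < k.+1) sigma (i j) (X *m Y)
    <= \prod_(1 <= j < k.+1) (sigma j X * sigma (i j) Y).
Proof.
have -> : \prod_(1 <= j < k.+1) (sigma j X * sigma (i j) Y) =
    \prod_(1 <= j < k.+1) (sigma (i j) (Y ^t*) * sigma j (X ^t*)).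
  by apply: eq_bigr => j _; rewrite !sigma_adj mulrC.
have -> : \prod_(1 <= j < k.+1) sigma (i j) (X *m Y) =
    \prod_(1 <= j < k.+1) sigma (i j) (Y ^t* *m X ^t*).
  by apply: eq_bigr => j _; rewrite -sigma_adj trmx_mul map_mxM.
exact: gelfand_naimark.
Qed.

Corollary gelfand_naimark_both X Y Z :
  \prod_(1 <= j < k.+1) sigma (i j) (X *m Y *m Z)
    <= \prod_(1 <= j < k.+1) (sigma j X * sigma (i j) Y * sigma j Z).
Proof.
apply: le_trans (gelfand_naimark _ _) _; rewrite 2!big_split /=.
apply: ler_wpM2r; last exact: gelfand_naimark_left.
by apply: prodr_ge0 => j _; exact: sigma_ge0.
Qed.

End GelfandNaimark.

(** * Perturbation by scalar matrices and inversion *)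

Section ShiftAndInverse.
Variables (R : realType) (n : nat).
Implicit Types (X M : 'M[R[i]]_n) (z : R[i]).

Lemma sigma_shift_le j X z : (1 <= j <= n)%N ->
  sigma j (X + z%:M) <= sigma j X + Normc.normc z.
Proof.
move=> jn; have [W rW Wle] := bottom_subspace X jn.
apply: (sigma_le (W := W)); rewrite ?rW // => v vW.
rewrite mulmxDr mul_mx_scalar (le_trans (ler_vnormD _ _)) //.
by rewrite vnormZ mulrDl lerD2r Wle.
Qed.

(** On the bottom subspace of dimension j, |v X| <= sigma_l (X) |v|, so the
    triangle inequality leaves at least |z| - sigma_l (X). *)
Lemma sigma_shift_ge j l X z : (1 <= j <= n)%N -> (j + l)%N = n.+1 ->
  Normc.normc z - sigma l X <= sigma j (X + z%:M).
Proof.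
move=> jn jl; have ln : (1 <= l <= n)%N by lia.
have [W rW Wle] := bottom_subspace X ln.
apply: (sigma_ge (W := W)) => [//||v vW]; first by lia.
rewrite mulrBl lerBlDr -vnormZ mulmxDr mul_mx_scalar.
have := ler_vnormD (v *m X + z *: v) ((-1) *: (v *m X)).
have -> : v *m X + z *: v + (-1) *: (v *m X) = z *: v.
  by rewrite scaleN1r addrAC subrr add0r.
move=> /le_trans-> //; rewrite lerD2l vnormZ normcN.
by rewrite Normc.normc1 mul1r Wle.
Qed.

(** M maps its top subspace W onto a subspace of the same dimension l, on
    which M^-1 has norm at most 1 / sigma_l (M). *)
Lemma sigma_invmx_le j l M : 0 < sigma n M -> (1 <= j <= n)%N ->
  (j + l)%N = n.+1 -> sigma j (invmx M) <= (sigma l M)^-1.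
Proof.
move=> M0 jn jl; have ln : (1 <= l <= n)%N by lia.
have Mu : M \in unitmx by apply: unitmx_sigma M0; lia.
have [W rW Wge] := top_subspace M ln.
have rWM : \rank (W *m M) = l by rewrite mxrankMfree ?row_free_unit.
apply: (sigma_le (W := W *m M)) => [//||v /submxP[w ->]].
  by rewrite rWM addnC jl.
have sl0 : 0 < sigma l M.
  by apply: lt_le_trans M0 (sigma_antitone _ _); lia.
rewrite mulmxA mulmxK // -(ler_pM2l sl0) mulrA divff ?gt_eqF // mul1r.
exact/Wge/submxMl.
Qed.

End ShiftAndInverse.

(** * The Cayley transform *)

Section Cayley.
Variables (R : realType) (n : nat).
Implicit Types (A B : 'M[R[i]]_n).

Lemma normc_i : Normc.normc ('i : R[i]) = 1.
Proof. by rewrite /= expr0n add0r expr1n sqrtr1. Qed.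

Lemma sub_i_shift A : A - 'i%:M = A + (- 'i)%:M.
Proof. by rewrite raddfN. Qed.

Lemma normcN_i : Normc.normc (- 'i : R[i]) = 1.
Proof. by rewrite normcN normc_i. Qed.

Lemma sigma_sub_i_le j A : (1 <= j <= n)%N ->
  sigma j (A - 'i%:M) <= 1 + sigma j A.
Proof.
by move=> jn; rewrite sub_i_shift [leRHS]addrC -normcN_i sigma_shift_le.
Qed.

Lemma sigma_sub_i_ge j l A : (1 <= j <= n)%N -> (j + l)%N = n.+1 ->
  1 - sigma l A <= sigma j (A - 'i%:M).
Proof. by move=> jn jl; rewrite sub_i_shift -normcN_i sigma_shift_ge. Qed.

Definition cayley_den A := A + 'i%:M.

Lemma cayley_den_le j A : (1 <= j <= n)%N ->
  sigma j (cayley_den A) <= 1 + sigma j A.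
Proof. by move=> jn; rewrite addrC -normc_i sigma_shift_le. Qed.

Lemma cayley_den_gt0 A : (1 <= n)%N -> strict_contraction A ->
  0 < sigma n (cayley_den A).
Proof.
move=> n1 hA; apply: lt_le_trans (sigma_shift_ge (l := 1) _ _ _ _); try lia.
by rewrite normc_i subr_gt0 hA.
Qed.

Lemma cayley_den_inv_le j A : strict_contraction A -> (1 <= j <= n)%N ->
  sigma j (invmx (cayley_den A)) <= (1 - sigma j A)^-1.
Proof.
move=> hA jn; have n1 : (1 <= n)%N by lia.
apply: le_trans (sigma_invmx_le (l := n.+1 - j) (cayley_den_gt0 n1 hA) jn _) _.
  by lia.
have lower : 1 - sigma j A <= sigma (n.+1 - j) (cayley_den A).
  by rewrite -normc_i; apply: sigma_shift_ge; lia.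
by rewrite lef_pV2 ?posrE // ?(lt_le_trans _ lower) // subr_gt0 hA.
Qed.

Lemma cayley_den_unit A : (1 <= n)%N -> strict_contraction A ->
  cayley_den A \in unitmx.
Proof. by move=> n1 hA; apply: unitmx_sigma (cayley_den_gt0 n1 hA). Qed.

Lemma cayleyE A : (1 <= n)%N -> strict_contraction A ->
  cayley A = 1%:M - ('i *+ 2) *: invmx (cayley_den A).
Proof.
move=> n1 hA; rewrite /cayley -/(cayley_den A).
have -> : A - 'i%:M = cayley_den A - ('i *+ 2)%:M.
  by rewrite /cayley_den mulr2n raddfD /= opprD addrA addrK.
by rewrite mulmxBl mulmxV ?cayley_den_unit // mul_scalar_mx.
Qed.

(** The resolvent identity for X |-> (X + iI)^-1, which applies because
    C(X) = I - 2i (X + iI)^-1. *)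
Lemma cayleyB A B : (1 <= n)%N ->
  strict_contraction A -> strict_contraction B ->
  cayley A - cayley B =
    ('i *+ 2) *: (invmx (cayley_den B) *m (A - B) *m invmx (cayley_den A)).
Proof.
move=> n1 hA hB; rewrite !cayleyE //.
have -> : A - B = cayley_den A - cayley_den B.
  by rewrite opprD addrACA subrr addr0.
rewrite mulmxBr mulVmx ?cayley_den_unit // mulmxBl mul1mx.
rewrite -mulmxA mulmxV ?cayley_den_unit // mulmx1 scalerBr.
by rewrite opprB addrC addrA addrNK.
Qed.

End Cayley.

(** * Bounds for Cayley transforms *)

Theorem theorem5 (R : realType) (n : nat) (A B : 'M[R[i]]_n)
    (hA : strict_contraction A) (hB : strict_contraction B)
    (k : nat) (hk : (1 <= k <= n)%N) (i : nat -> nat)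
    (i_range : forall j : nat, (1 <= j <= k)%N -> (1 <= i j <= n)%N)
    (i_incr : forall j l : nat, (1 <= j)%N -> (j < l)%N -> (l <= k)%N ->
       (i j < i l)%N) :
  (\prod_(1 <= j < k.+1) ((1 - sigma (n - i j + 1) A) / (1 + sigma j A))
     <= \prod_(1 <= j < k.+1) sigma (i j) (cayley A)
   /\
   \prod_(1 <= j < k.+1) sigma (i j) (cayley A)
     <= \prod_(1 <= j < k.+1) ((1 + sigma (i j) A) / (1 - sigma j A)))
  /\
  (\prod_(1 <= j < k.+1)
       (2 * sigma (i j) (A - B) / ((1 + sigma j A) * (1 + sigma j B)))
     <= \prod_(1 <= j < k.+1) sigma (i j) (cayley A - cayley B)
   /\
   \prod_(1 <= j < k.+1) sigma (i j) (cayley A - cayley B)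
     <= \prod_(1 <= j < k.+1)
          (2 * sigma (i j) (A - B) / ((1 - sigma j A) * (1 - sigma j B)))).
Proof.
have n1 : (1 <= n)%N by lia.
have k_n j : (1 <= j < k.+1)%N -> (1 <= j <= n)%N by lia.
have sub0 (X : 'M[R[i]]_n) j :
    strict_contraction X -> (1 <= j <= n)%N -> 0 < 1 - sigma j X.
  by move=> hX jn; rewrite subr_gt0; exact: hX.
have add0 (X : 'M[R[i]]_n) j : 0 < 1 + sigma j X.
  exact: ltr_wpDr (sigma_ge0 _ _) ltr01.
have Au := cayley_den_unit n1 hA; have Bu := cayley_den_unit n1 hB.
have normC2i : Normc.normc ('i *+ 2 : R[i]) = 2.
  by rewrite normcMn normc_i.
split; split.
- rewrite prodf_div ler_pdivrMr; last by apply: prodr_gt0 => j _; exact: add0.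
  rewrite -big_split /=.
  apply: (@le_trans _ _ (\prod_(1 <= j < k.+1) sigma (i j) (A - 'i%:M))).
    apply: ler_prod_nat => j jk; have ij := i_range j jk.
    rewrite ltW ?sub0 //=; last by lia.
    by apply: sigma_sub_i_ge => //; lia.
  have -> : A - 'i%:M = cayley A *m cayley_den A.
    by rewrite /cayley -mulmxA mulVmx ?mulmx1.
  apply: le_trans (gelfand_naimark hk i_range i_incr _ _) _.
  apply: ler_prod_nat => j jk; rewrite mulr_ge0 ?sigma_ge0 //=.
  apply: ler_wpM2l; first exact: sigma_ge0.
  exact: cayley_den_le (k_n _ jk).
- apply: le_trans (gelfand_naimark hk i_range i_incr _ _) _.
  apply: ler_prod_nat => j jk; rewrite mulr_ge0 ?sigma_ge0 //=.
  apply: ler_pM; [exact: sigma_ge0 | exact: sigma_ge0 | |].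
    exact: sigma_sub_i_le (i_range j jk).
  exact: cayley_den_inv_le hA (k_n _ jk).
- rewrite prodf_div ler_pdivrMr; last first.
    by apply: prodr_gt0 => j _; rewrite mulr_gt0.
  rewrite -big_split /=.
  have -> : \prod_(1 <= j < k.+1) (2 * sigma (i j) (A - B)) =
    \prod_(1 <= j < k.+1)
      sigma (i j) (cayley_den B *m (cayley A - cayley B) *m cayley_den A).
    apply: eq_big_nat => j jk; rewrite cayleyB //.
    rewrite -scalemxAr -scalemxAl !mulmxA mulmxV // mul1mx -mulmxA mulVmx //.
    by rewrite mulmx1 sigma_scale ?i_range // normC2i.
  apply: le_trans (gelfand_naimark_both hk i_range i_incr _ _ _) _.
  apply: ler_prod_nat => j jk; rewrite !mulr_ge0 ?sigma_ge0 //=.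
  rewrite [leLHS]mulrAC mulrC ler_wpM2l ?sigma_ge0 // mulrC.
  apply: ler_pM; [exact: sigma_ge0 | exact: sigma_ge0 | |];
    exact: cayley_den_le (k_n _ jk).
rewrite cayleyB //.
have -> : \prod_(1 <= j < k.+1) sigma (i j) (('i *+ 2)
     *: (invmx (cayley_den B) *m (A - B) *m invmx (cayley_den A)))
  = \prod_(1 <= j < k.+1)
     (2 * sigma (i j) (invmx (cayley_den B) *m (A - B) *m invmx (cayley_den A))).
  by apply: eq_big_nat => j jk; rewrite sigma_scale ?i_range // normC2i.
have split2 (F : nat -> R) :
    \prod_(1 <= j < k.+1) (2 * F j) = 2 ^+ k * \prod_(1 <= j < k.+1) F j.
  by rewrite big_split /= prodr_const_nat subn1.
under [leRHS]eq_bigr do rewrite -mulrA.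
rewrite !split2 ler_wpM2l ?exprn_ge0 //.
apply: le_trans (gelfand_naimark_both hk i_range i_incr _ _ _) _.
apply: ler_prod_nat => j jk; rewrite !mulr_ge0 ?sigma_ge0 //=.
rewrite invfM [leLHS]mulrAC mulrC ler_wpM2l ?sigma_ge0 // mulrC.
apply: ler_pM; [exact: sigma_ge0 | exact: sigma_ge0 | |].
  exact: cayley_den_inv_le hA (k_n _ jk).
exact: cayley_den_inv_le hB (k_n _ jk).
Qed.
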